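(* Let $N\ge1$ be an integer and $\lambda_1,\lambda_2,\lambda_3\in\mathbb{C}$ with $\lambda_1,\lambda_2,\lambda_3\notin\{0,-1,\dots,-(N-1)\}$ and $\lambda_1+\lambda_2,\ \lambda_2+\lambda_3,\ \lambda_1+\lambda_2+\lambda_3\notin\{0,-1,\dots,-(2N-2)\}$. For $l=0,1,\dots,N$ define the polynomials in $x,y,z$ \[v_l=(x+y+z)^{N-l}(x+y)^lP_{N-l}^{\lambda_1+\lambda_2+2l,\lambda_3}\Bigl(\frac{z-(x+y)}{x+y+z}\Bigr)P_l^{\lambda_1,\lambda_2}\Bigl(\frac{y-x}{x+y}\Bigr),\] \[w_l=(x+y+z)^{N-l}(y+z)^lP_{N-l}^{\lambda_1,\lambda_2+\lambda_3+2l}\Bigl(\frac{y+z-x}{x+y+z}\Bigr)P_l^{\lambda_2,\lambda_3}\Bigl(\frac{z-y}{y+z}\Bigr).\] Then, for $l=0,1,\dots,N$, \[w_l=\sum_{k=0}^N\binom Nl\frac{(\lambda_2)_l(\lambda_1)_{N-l}(\lambda_1+\lambda_2+\lambda_3+N-1)_k}{(\lambda_1)_k(\lambda_1+\lambda_2+k-1)_k(\lambda_1+\lambda_2+2k)_{N-k}}\,R_{l,k}\,v_k,\] \[v_l=\sum_{k=0}^N\binom Nl\frac{(\lambda_2)_l(\lambda_3)_{N-l}(\lambda_1+\lambda_2+\lambda_3+N-1)_k}{(\lambda_3)_k(\lambda_2+\lambda_3+k-1)_k(\lambda_2+\lambda_3+2k)_{N-k}}\,R_{k,l}\,w_k,\]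 where \[R_{k,l}={}_4F_3\left(\begin{array}{c}-k,\ k+\lambda_2+\lambda_3-1,\ -l,\ l+\lambda_1+\lambda_2-1\\ \lambda_2,\ \lambda_1+\lambda_2+\lambda_3+N-1,\ -N\end{array};1\right),\qquad k,l=0,\dots,N.\]
   Context: Pochhammer symbols: $(x)_m=\prod_{i=0}^{m-1}(x+i)$. Hypergeometric series: ${}_4F_3\left(\begin{array}{c}a_1,\dots,a_4\\ b_1,b_2,b_3\end{array};x\right)=\sum_{n\ge0}\frac{(a_1)_n\cdots(a_4)_n}{(b_1)_n(b_2)_n(b_3)_n}\frac{x^n}{n!}$; in $R_{k,l}$ the sum runs over $0\le n\le\min(k,l)$. The number $R_{k,l}$ is the value at $x=l$ of the $k$-th Racah polynomial. Jacobi polynomials (shifted parametrisation, usual parameters $\alpha=\lambda-1,\beta=\lambda'-1$): for $\lambda,\lambda'\in\mathbb{C}$, $l\ge0$, \[P^{\lambda,\lambda'}_l(x)=\frac1{2^l}\sum_{s=0}^l(-1)^s\binom{l+\lambda-1}{l-s}\binom{l+\lambda'-1}{s}(1-x)^s(1+x)^{l-s},\] with generalised binomial coefficients $\binom{a}{j}=\frac{a(a-1)\cdots(a-j+1)}{j!}$. *)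

(* Defs.v *)
From HB Require Import structures.
From mathcomp Require Import all_boot all_order all_algebra.
From mathcomp Require Import reals complex.
From mathcomp Require Import mpoly.

Set Implicit Arguments.
Unset Strict Implicit.
Unset Printing Implicit Defensive.

Import GRing.Theory.
Local Open Scope ring_scope.
Local Open Scope complex_scope.

Section SpecialFunctions.
Variable K : fieldType.

Definition pochhammer (a : K) (m : nat) : K := \prod_(i < m) (a + i%:R).

Definition gbinomial (a : K) (j : nat) : K :=
  (\prod_(i < j) (a - i%:R)) / (j`!)%:R.

(* Sum of the terms n = 0, ..., m of the 4F3 series; cutting the sum is
   needed because division is total and a lower parameter may be a negative
   integer. *)
Definition hyp4F3_upto (m : nat) (a1 a2 a3 a4 b1 b2 b3 x : K) : K :=
  \sum_(n < m.+1)
    (pochhammer a1 n * pochhammer a2 n * pochhammer a3 n * pochhammer a4 n)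
    / (pochhammer b1 n * pochhammer b2 n * pochhammer b3 n)
    * (x ^+ n / (n`!)%:R).

Definition racah (N : nat) (lam1 lam2 lam3 : K) (k l : nat) : K :=
  hyp4F3_upto (minn k l)
    (- k%:R) (k%:R + lam2 + lam3 - 1) (- l%:R) (l%:R + lam1 + lam2 - 1)
    lam2 (lam1 + lam2 + lam3 + N%:R - 1) (- N%:R)
    1.

Definition jacobi (l : nat) (lam lam' : K) : {poly K} :=
  (2%:R ^+ l)^-1 *:
  \sum_(s < l.+1)
    ((-1) ^+ s * gbinomial (l%:R + lam - 1) (l - s)
               * gbinomial (l%:R + lam' - 1) s)
    *: ((1 - 'X) ^+ s * (1 + 'X) ^+ (l - s)).

Lemma size_jacobi l lam lam' : (size (jacobi l lam lam') <= l.+1)%N.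
Proof.
apply: leq_trans (size_scale_leq _ _) _.
apply: leq_trans (size_sum _ _ _) _; apply/bigmax_leqP => s _.
apply: leq_trans (size_scale_leq _ _) _.
have sX (e : {poly K}) n : (size e <= 2)%N -> (size (e ^+ n) <= n.+1)%N.
  move=> he; apply: leq_trans (size_poly_exp_leq _ _) _.
  by rewrite ltnS -[leqRHS]mul1n leq_mul2r -subn1 leq_subLR he orbT.
apply: leq_trans (size_polyMleq _ _) _.
have h1 : (size (1 - 'X : {poly K})%R <= 2)%N.
  apply: leq_trans (size_polyD _ _) _.
  by rewrite size_polyN size_polyX size_poly1.
have h2 : (size (1 + 'X : {poly K})%R <= 2)%N.
  apply: leq_trans (size_polyD _ _) _.
  by rewrite size_polyX size_poly1.
have ls : (s + (l - s) = l)%N by rewrite subnKC // -ltnS.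
have := leq_add (sX _ s h1) (sX _ (l - s)%N h2).
by rewrite addSn addnS ls; case: (_ + _)%N.
Qed.

End SpecialFunctions.

Section Bases.
Variable K : fieldType.

(* The field of rational functions K(x, y, z); the quotients inside the
   Jacobi polynomials are taken there. *)
Definition ratfun := {fraction {mpoly K[3]}}.

Definition cst (c : K) : ratfun := tofrac (c%:MP_[3]).

Definition varx : ratfun := tofrac ('X_(inord 0) : {mpoly K[3]}).
Definition vary : ratfun := tofrac ('X_(inord 1) : {mpoly K[3]}).
Definition varz : ratfun := tofrac ('X_(inord 2) : {mpoly K[3]}).

Definition jacobi_at (l : nat) (lam lam' : K) (u : ratfun) : ratfun :=
  (map_poly cst (jacobi l lam lam')).[u].

Local Notation x := varx.
Local Notation y := vary.
Local Notation z := varz.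

Definition basis_v (N : nat) (lam1 lam2 lam3 : K) (l : nat) : ratfun :=
  (x + y + z) ^+ (N - l) * (x + y) ^+ l
  * jacobi_at (N - l) (lam1 + lam2 + 2%:R * l%:R) lam3
      ((z - (x + y)) / (x + y + z))
  * jacobi_at l lam1 lam2 ((y - x) / (x + y)).

Definition basis_w (N : nat) (lam1 lam2 lam3 : K) (l : nat) : ratfun :=
  (x + y + z) ^+ (N - l) * (y + z) ^+ l
  * jacobi_at (N - l) lam1 (lam2 + lam3 + 2%:R * l%:R)
      ((y + z - x) / (x + y + z))
  * jacobi_at l lam2 lam3 ((z - y) / (y + z)).

Lemma homogenized_jacobi l lam lam' (a b : {mpoly K[3]}) : b != 0 ->
  exists p : {mpoly K[3]},
    tofrac b ^+ l * jacobi_at l lam lam' (tofrac a / tofrac b) = tofrac p.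
Proof.
move=> b0; have tb0 : tofrac b != 0 by rewrite tofrac_eq0.
exists (\sum_(i < l.+1) ((jacobi l lam lam')`_i)%:MP_[3] * a ^+ i * b ^+ (l - i)).
have sz : (size (map_poly cst (jacobi l lam lam')) <= l.+1)%N.
  exact: leq_trans (size_poly _ _) (size_jacobi _ _ _).
rewrite /jacobi_at (horner_coef_wide _ sz) mulr_sumr rmorph_sum /=.
apply: eq_bigr => i _; rewrite coef_map_id0; last by rewrite /cst mpolyC0 rmorph0.
rewrite !rmorphM !rmorphXn /= expr_div_n -/(cst _).
have il : (i <= l)%N by rewrite -ltnS.
rewrite -{1}(subnK il) exprD mulrC -!mulrA; congr (_ * _); congr (_ * _).
by rewrite [X in _ * X]mulrC mulKf // expf_neq0.
Qed.

Lemma sum_vars_neq0 :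
  [/\ 'X_(inord 0) + 'X_(inord 1) != 0 :> {mpoly K[3]},
      'X_(inord 1) + 'X_(inord 2) != 0 :> {mpoly K[3]} &
      'X_(inord 0) + 'X_(inord 1) + 'X_(inord 2) != 0 :> {mpoly K[3]}].
Proof.
split; apply/negP => /eqP /(congr1 (mcoeff U_(inord 1)%MM)) /eqP.
all: rewrite mcoeff0 !mcoeffD !mcoeffXU -!val_eqE /= !inordK //=.
all: by rewrite ?addr0 ?add0r oner_eq0.
Qed.

(* The elements of K(x, y, z) defined above are polynomials. *)
Lemma basis_v_polynomial N lam1 lam2 lam3 l :
  exists p : {mpoly K[3]}, basis_v N lam1 lam2 lam3 l = tofrac p.
Proof.
have [n01 n12 n012] := sum_vars_neq0.
have [p hp] := homogenized_jacobi (N - l) (lam1 + lam2 + 2%:R * l%:R) lam3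
  ('X_(inord 2) - ('X_(inord 0) + 'X_(inord 1))) n012.
have [q hq] := homogenized_jacobi l lam1 lam2 ('X_(inord 1) - 'X_(inord 0)) n01.
exists (p * q); rewrite rmorphM /= -hp -hq !(rmorphB, rmorphD) /=.
by rewrite /basis_v -mulrA mulrACA.
Qed.

Lemma basis_w_polynomial N lam1 lam2 lam3 l :
  exists p : {mpoly K[3]}, basis_w N lam1 lam2 lam3 l = tofrac p.
Proof.
have [n01 n12 n012] := sum_vars_neq0.
have [p hp] := homogenized_jacobi (N - l) lam1 (lam2 + lam3 + 2%:R * l%:R)
  ('X_(inord 1) + 'X_(inord 2) - 'X_(inord 0)) n012.
have [q hq] := homogenized_jacobi l lam2 lam3 ('X_(inord 2) - 'X_(inord 1)) n12.
exists (p * q); rewrite rmorphM /= -hp -hq !(rmorphB, rmorphD) /=.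
by rewrite /basis_w -mulrA mulrACA.
Qed.

End Bases.

(* Main.v *)
(* The homogenised Jacobi polynomials are harmonic for a weighted Laplacian
   L = sum_i (x_i d_i^2 + lam_i d_i), because their coefficients satisfy the
   corresponding two-term recurrence; consequently L kills all v_l and w_l. A form
   of degree N killed by L is determined by its restriction to x = 0, since the
   equation L f = 0 computes the coefficients of x^(a+1) from those of x^a. At
   x = 0 the expansion of w_l becomes a one-variable identity: the 2F1 form of the
   Jacobi polynomials expands w_l(0,y,z) in the products y^n (y+z)^(N-n), an
   inversion formula expands each of these in the v_k(0,y,z), and the composite of
   the two triangular transformations is the 4F3 sum. The expansion of v_l follows
   by exchanging x with z and lam1 with lam3. *)

From HB Require Import structures.
Require Import Defs.
From mathcomp Require Import all_boot all_order all_algebra.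
From mathcomp Require Import reals complex.
From mathcomp Require Import mpoly ring zify.

Set Implicit Arguments.
Unset Strict Implicit.
Unset Printing Implicit Defensive.

Import GRing.Theory.
Local Open Scope ring_scope.
Local Open Scope complex_scope.

(** * Pochhammer symbols and the Chu-Vandermonde identity *)

Section Pochhammer.
Variable K : fieldType.
Implicit Types (a b : K) (m n s : nat).

Lemma pochhammer0 a : pochhammer a 0 = 1.
Proof. by rewrite /pochhammer big_ord0. Qed.

Lemma pochhammerSr a n : pochhammer a n.+1 = pochhammer a n * (a + n%:R).
Proof. by rewrite /pochhammer big_ord_recr. Qed.

Lemma pochhammerD a m n :
  pochhammer a (m + n) = pochhammer a m * pochhammer (a + m%:R) n.
Proof.
elim: n => [|n IHn]; first by rewrite addn0 pochhammer0 mulr1.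
by rewrite addnS !pochhammerSr IHn natrD !mulrA addrA.
Qed.

Lemma pochhammerSl a n : pochhammer a n.+1 = a * pochhammer (a + 1) n.
Proof.
by rewrite -add1n pochhammerD pochhammerSr pochhammer0 mul1r addr0.
Qed.

Lemma pochhammer_neq0 a n :
  (forall i, (i < n)%N -> a + i%:R != 0) -> pochhammer a n != 0.
Proof. by move=> h; apply/prodf_neq0 => i _; apply: h. Qed.

Lemma pochhammer_reflect a n :
  pochhammer (1 - a - n%:R) n = (-1) ^+ n * pochhammer a n.
Proof.
elim: n => [|n IHn]; first by rewrite !pochhammer0 mulr1.
rewrite pochhammerSl pochhammerSr exprS.
rewrite (_ : 1 - a - n.+1%:R + 1 = 1 - a - n%:R); last by rewrite -natr1; ring.
by rewrite IHn -natr1; ring.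
Qed.

Lemma pochhammer_oppn_fact N n : (n <= N)%N ->
  pochhammer (- N%:R : K) n * ((N - n)`!)%:R = (-1) ^+ n * (N`!)%:R.
Proof.
elim: n => [|n IHn] lenN; first by rewrite pochhammer0 subn0.
rewrite exprS -mulrA -IHn ?(ltnW lenN)// pochhammerSr.
rewrite -[in RHS](subnSK lenN) factS natrM subnSK// natrB ?(ltnW lenN)//.
ring.
Qed.

Lemma pochhammer_oppn_eq0 N n : (N < n)%N -> pochhammer (- N%:R : K) n = 0.
Proof. by move=> h; rewrite /pochhammer (bigD1 (Ordinal h))//= addNr mul0r. Qed.

Lemma gbinomialE a j : gbinomial (a + j%:R - 1) j = pochhammer a j / (j`!)%:R.
Proof.
congr (_ / _); rewrite /pochhammer (reindex_inj rev_ord_inj) /=.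
by apply: eq_bigr => i _; rewrite natrB// -natr1; ring.
Qed.

(** Chu-Vandermonde with denominators cleared, so that no parameter has to avoid a zero. Induction
    on [s]: Pascal's rule splits the sum into two halves, which together contribute the new factor
    [a - b + s]. *)
Lemma pochhammer_vandermonde a b s :
  \sum_(n < s.+1) (-1) ^+ n * 'C(s, n)%:R *
     (pochhammer b n * pochhammer (a + n%:R) (s - n)) = pochhammer (a - b) s.
Proof.
elim: s a b => [|s IHs] a b.
  by rewrite big_ord_recl big_ord0 bin0 subn0 !pochhammer0; ring.
rewrite big_ord_recl.
under eq_bigr => i _ do rewrite lift0 binS natrD mulrDr mulrDl.
rewrite big_split /= addrA.
(* In the half carrying ['C(s, n)], each symbol based at [a + n] ends in the same factor [a + s]. *)
have -> : (-1) ^+ 0 * 'C(s.+1, 0)%:R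
      * (pochhammer b 0 * pochhammer (a + 0%:R) (s.+1 - 0)) +
    \sum_(i < s.+1) (-1) ^+ i.+1 * 'C(s, i.+1)%:R
      * (pochhammer b i.+1 * pochhammer (a + i.+1%:R) (s.+1 - i.+1))
    = (a + s%:R) * pochhammer (a - b) s.
  rewrite -IHs mulr_sumr big_ord_recr /= (@bin_small s s.+1)// mulr0 mul0r !addr0.
  rewrite [RHS]big_ord_recl; congr (_ + _).
    by rewrite !bin0 /= ?addr0 !subn0 pochhammerSr; ring.
  apply: eq_bigr => i _; rewrite lift0 subSS.
  rewrite -(subnSK (ltn_ord i)) [X in _ * (_ * X) = _]pochhammerSr.
  by rewrite natrB ?ltn_ord//; ring.
(* Once the leading factor [b] is taken out, the other half is the induction hypothesis at [a + 1]
   and [b + 1], which have the same difference. *)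
have -> : \sum_(i < s.+1) (-1) ^+ i.+1 * 'C(s, i)%:R
      * (pochhammer b i.+1 * pochhammer (a + i.+1%:R) (s.+1 - i.+1))
    = - b * pochhammer (a - b) s.
  rewrite (_ : a - b = (a + 1) - (b + 1)); last by ring.
  rewrite -IHs mulr_sumr; apply: eq_bigr => i _.
  rewrite subSS pochhammerSl exprS -natr1
    (_ : a + (i%:R + 1) = a + 1 + i%:R); last by ring.
  by ring.
by rewrite pochhammerSr; ring.
Qed.

End Pochhammer.

(** * Homogenised Jacobi polynomials and their 2F1 form *)

Section HomogeneousJacobi.
Variable K : fieldType.
Hypothesis char0 : [pchar K] =i pred0.
Implicit Types (lam : K) (l s n : nat).

Lemma natr_eq0 n : (n%:R == 0 :> K) = (n == 0%N).
Proof. exact: (pcharf0P K).1. Qed.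

Lemma natr_fact_neq0 n : (n`!)%:R != 0 :> K.
Proof. by rewrite natr_eq0 -lt0n fact_gt0. Qed.

Lemma natr_bin m n : (n <= m)%N ->
  'C(m, n)%:R = (m`!)%:R / ((n`!)%:R * ((m - n)`!)%:R) :> K.
Proof.
move=> nm; rewrite -(bin_fact nm) natrM natrM mulfK//.
by rewrite mulf_neq0 ?natr_fact_neq0.
Qed.

Lemma pochhammer_oppn N n : (n <= N)%N ->
  pochhammer (- N%:R : K) n = (-1) ^+ n * (N`!)%:R / ((N - n)`!)%:R.
Proof.
by move=> nN; rewrite -pochhammer_oppn_fact// mulfK// natr_fact_neq0.
Qed.

Definition jacobi_coef l lam lam' s : K :=
  (-1) ^+ s * gbinomial (l%:R + lam - 1) (l - s)
  * gbinomial (l%:R + lam' - 1) s.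

(** Formally [(a + b)^l P_l((b - a) / (a + b))], where the powers of 2 and of [a + b] cancel. Being
    division-free in [a] and [b], it makes sense in every commutative algebra and commutes with
    substitutions. *)
Definition hjacobi (A : comAlgType K) l lam lam' (a b : A) : A :=
  \sum_(s < l.+1) jacobi_coef l lam lam' s *: (a ^+ s * b ^+ (l - s)).

Lemma jacobi_coefE l lam lam' s : (s <= l)%N ->
  jacobi_coef l lam lam' s =
  (-1) ^+ s * (pochhammer (lam + s%:R) (l - s) / ((l - s)`!)%:R)
  * (pochhammer (lam' + (l - s)%:R) s / (s`!)%:R).
Proof.
move=> sl; rewrite -!gbinomialE /jacobi_coef natrB//; congr (_ * _ * _).
  by congr gbinomial; ring.
by congr gbinomial; ring.
Qed.

(** The two summands are what neighbouring terms of [hjacobi] contribute to the monomial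
    [a^s b^(l - s - 1)] when a weighted Laplacian is applied. *)
Lemma jacobi_coef_rec l lam lam' s : (s < l)%N ->
  jacobi_coef l lam lam' s.+1 * (s.+1%:R * (s%:R + lam))
  + jacobi_coef l lam lam' s
    * ((l - s)%:R * ((l - s.+1)%:R + lam')) = 0.
Proof.
move=> sl; rewrite !jacobi_coefE// ?(ltnW sl)// -(subnSK sl) !factS !natrM.
rewrite [pochhammer (lam + s%:R) _]pochhammerSl [pochhammer _ s.+1]pochhammerSr exprS.
rewrite (_ : lam + s%:R + 1 = lam + s.+1%:R); last by rewrite -natr1; ring.
rewrite -[(l - s.+1).+1%:R]natr1 -[s.+1%:R]natr1.
have E : pochhammer (lam' + (l - s.+1)%:R) s * (lam' + (l - s.+1)%:R + s%:R)
   = (lam' + (l - s.+1)%:R) * pochhammer (lam' + ((l - s.+1)%:R + 1)) s.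
  by rewrite -pochhammerSr pochhammerSl addrA.
have := natr_fact_neq0 (l - s.+1); have := natr_fact_neq0 s.
have : s%:R + 1 != 0 :> K by rewrite natr1 natr_eq0.
have : (l - s.+1)%:R + 1 != 0 :> K by rewrite natr1 natr_eq0.
rewrite E.
move=> ? ? ? ?; field.
by apply/and4P; split.
Qed.

Lemma hjacobi_morph (A B : comAlgType K) (f : {lrmorphism A -> B})
  l lam lam' (a b : A) :
  f (hjacobi l lam lam' a b) = hjacobi l lam lam' (f a) (f b).
Proof.
by rewrite rmorph_sum /=; apply: eq_bigr => s _; rewrite linearZ /= rmorphM !rmorphXn.
Qed.

Lemma hjacobi0l (A : comAlgType K) l lam lam' (b : A) :
  hjacobi l lam lam' 0 b = (pochhammer lam l / (l`!)%:R) *: b ^+ l.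
Proof.
rewrite /hjacobi big_ord_recl big1 ?addr0 => [|i _].
  by rewrite jacobi_coefE// subn0 mul1r pochhammer0 fact0 divr1 mulr1 addr0 mul1r.
by rewrite expr0n mul0r scaler0.
Qed.

(** Homogeneous form of the reflection of the Jacobi polynomials under [x -> -x], obtained by
    reversing the sum. *)
Lemma hjacobi_swap (A : comAlgType K) l lam lam' (a b : A) :
  hjacobi l lam' lam b a = (-1) ^+ l *: hjacobi l lam lam' a b.
Proof.
rewrite /hjacobi scaler_sumr (reindex_inj rev_ord_inj) /=.
apply: eq_bigr => s _; have sl : (s <= l)%N by rewrite -ltnS.
rewrite subSS scalerA subKn// [b ^+ _ * _]mulrC; congr (_ *: _).
rewrite !jacobi_coefE ?leq_subr// subKn//.
have -> : (-1) ^+ l = (-1) ^+ (l - s) * (-1) ^+ s :> K by rewrite -exprD subnK.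
by rewrite -!mulrA signrMK; ring.
Qed.

Lemma sum_ord_shift (V : zmodType) k N (F : nat -> V) : (k <= N)%N ->
  \sum_(m < (N - k).+1) F m = \sum_(j < N.+1 | (k <= j)%N) F (j - k)%N.
Proof.
move=> kN; rewrite -(big_mkord xpredT F).
rewrite -(big_mkord (fun j => k <= j)%N (fun j => F (j - k)%N)).
rewrite [RHS](big_cat_nat (n := k)) ?leqW//=.
rewrite [X in _ = X + _]big1_seq ?add0r => [|i]; last first.
  by rewrite mem_index_iota /= => /andP[ki ik]; rewrite ltnNge ki in ik.
have /= := big_addn (idx := 0) (op := +%R) 0 N.+1 k
  (fun j => k <= j)%N (fun j => F (j - k)%N).
rewrite add0n => ->; rewrite subSn// [LHS]big_nat [RHS]big_nat_cond.
by apply: eq_big => [i|i _]; rewrite ?leq_addl ?andbT// addnK.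
Qed.

Lemma mul_exprD_homogeneous (A : comAlgType K) n l (a b : A) : (n <= l)%N ->
  a ^+ n * (a + b) ^+ (l - n) =
  \sum_(s < l.+1 | (n <= s)%N) (a ^+ s * b ^+ (l - s)) *+ 'C(l - n, s - n).
Proof.
move=> nl; rewrite addrC exprDn mulr_sumr.
rewrite (sum_ord_shift (fun i =>
  a ^+ n * (b ^+ (l - n - i) * a ^+ i *+ 'C(l - n, i))) nl).
apply: eq_bigr => s ns; rewrite mulrnAr; congr (_ *+ _).
by rewrite mulrCA -exprD subnKC// mulrC subnBA ?subnK.
Qed.

(* Comparing coefficients of [a ^+ s * b ^+ (l - s)] turns this 2F1 form of the
   Jacobi polynomial into the Chu-Vandermonde identity. *)
Lemma hjacobi_hypergeometric (A : comAlgType K) l lam lam' (a b : A) :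
  (forall i, (i < l)%N -> lam + i%:R != 0) ->
  hjacobi l lam lam' a b =
  \sum_(n < l.+1)
     (pochhammer lam l / (l`!)%:R
      * (pochhammer (- l%:R) n * pochhammer (l%:R + lam + lam' - 1) n
         / (pochhammer lam n * (n`!)%:R)))
     *: (a ^+ n * (a + b) ^+ (l - n)).
Proof.
move=> lam_neq0.
pose c n : K := pochhammer lam l / (l`!)%:R
   * (pochhammer (- l%:R) n * pochhammer (l%:R + lam + lam' - 1) n
      / (pochhammer lam n * (n`!)%:R)).
transitivity (\sum_(n < l.+1) \sum_(s < l.+1 | (n <= s)%N)
    (c n * 'C(l - n, s - n)%:R) *: (a ^+ s * b ^+ (l - s))); last first.
  apply: eq_bigr => n _.
  rewrite mul_exprD_homogeneous; last by rewrite -ltnS.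
  rewrite scaler_sumr.
  by apply: eq_bigr => s _; rewrite -scalerA scaler_nat.
rewrite (exchange_big_dep xpredT)//=; apply: eq_bigr => s _.
rewrite -scaler_suml; congr (_ *: _).
have sl : (s <= l)%N by rewrite -ltnS.
have poch_neq0 n : (n <= l)%N -> pochhammer lam n != 0.
  by move=> nl; apply: pochhammer_neq0 => i /leq_trans/(_ nl); apply: lam_neq0.
rewrite jacobi_coefE//.
(* Reflection moves the base to [1 - l - lam'], which is [lam] minus [l + lam + lam' - 1]: the
   closed side of Chu-Vandermonde for these two parameters. *)
rewrite -[X in pochhammer X s](_ : 1 - (1 - l%:R - lam' ) - s%:R = _); last first.
  by rewrite natrB//; ring.
rewrite pochhammer_reflect.
rewrite (_ : 1 - l%:R - lam' = lam - (l%:R + lam + lam' - 1)); last by ring.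
rewrite -pochhammer_vandermonde.
rewrite -(big_ord_widen _ (fun n => c n * 'C(l - n, s - n)%:R) (sl : (s < l.+1)%N)).
rewrite mulr_sumr mulr_suml mulr_sumr /c.
apply: eq_bigr => n _; have ns : (n <= s)%N by rewrite -ltnS.
have nl := leq_trans ns sl.
(* The first factor cancels the denominator of the 2F1 term, the second belongs to Chu-Vandermonde,
   the third to [jacobi_coef]. *)
have -> : pochhammer lam l = pochhammer lam n
    * pochhammer (lam + n%:R) (s - n) * pochhammer (lam + s%:R) (l - s).
  by rewrite -pochhammerD subnKC// -pochhammerD subnKC.
rewrite (@natr_bin s n)// natr_bin ?leq_sub2r// subnBA// subnK// pochhammer_oppn//.
rewrite -mulrA mulrCA -!mulrA signrMK !mulrA.

have := poch_neq0 n nl.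
have := natr_fact_neq0 (l - n); have := natr_fact_neq0 (l - s).
have := natr_fact_neq0 (s - n); have := natr_fact_neq0 s.
have := natr_fact_neq0 n; have := natr_fact_neq0 l.
by move=> *; field; do !(apply/andP; split).
Qed.

End HomogeneousJacobi.

(** * Inversion of the 2F1 expansion, and the Racah sum in two variables *)

Section ConnectionCoefficients.
Variable K : fieldType.
Hypothesis char0 : [pchar K] =i pred0.
Implicit Types (c e : K) (i j k n M N : nat).

(* Gosper's algorithm yields the telescoping primitive [F]. *)
Lemma alternating_sum_pochhammer e M : (0 < M)%N ->
  (forall i, (0 < i < M.*2)%N -> e + i%:R != 0) ->
  \sum_(i < M.+1) (-1) ^+ i * 'C(M, i)%:R
    / (pochhammer (e + i%:R) i * pochhammer (e + 2%:R * i%:R + 1) (M - i)) = 0.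
Proof.
case: M => // m _ e_neq0.
pose F i : K := if i is i'.+1 then
  (-1) ^+ i' * 'C(m, i')%:R / pochhammer (e + i%:R) m.+1 else 0.
rewrite -(big_mkord xpredT (fun i => (-1) ^+ i * 'C(m.+1, i)%:R
    / (pochhammer (e + i%:R) i * pochhammer (e + 2%:R * i%:R + 1) (m.+1 - i)))).
rewrite (telescope_sumr_eq F) //=.
  by rewrite /F bin_small// mulr0 mul0r subr0.
move=> [_|i im].
  by rewrite /F subr0 !bin0 subn0 pochhammer0 mul1r mulr0 addr0.
(* At the last index ['C(m, m.+1)] is zero, so the primitive ends at 0 and its increment is a single
   term. *)
rewrite /F; have [->|neq_im] := eqVneq i m.
  by rewrite binn (@bin_small m m.+1)// subnn pochhammer0 mulr1 binn exprS; ring.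
have {neq_im}im : (i < m)%N by rewrite ltn_neqAle neq_im -ltnS -ltnS.
have -> : pochhammer (e + i.+2%:R) m.+1 = pochhammer (e + i.+2%:R) i *
    ((e + 2%:R * i.+1%:R) * pochhammer (e + 2%:R * i.+1%:R + 1) (m - i)).
  rewrite (_ : m.+1 = i + (m - i).+1)%N; last by rewrite addnS subnKC// ltnW.
  rewrite pochhammerD [X in _ * X = _]pochhammerSl.
  by congr (_ * (_ * pochhammer _ _)); rewrite -!natr1; ring.
have -> : pochhammer (e + i.+1%:R) m.+1 = pochhammer (e + i.+1%:R) i.+1 *
    ((e + 2%:R * i.+1%:R) * pochhammer (e + 2%:R * i.+1%:R + 1) (m - i.+1)).
  rewrite (_ : m.+1 = i.+1 + (m - i.+1).+1)%N; last by rewrite addnS subnKC.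
  rewrite pochhammerD [X in _ * X = _]pochhammerSl.
  by congr (_ * (_ * pochhammer _ _)); rewrite -!natr1; ring.
rewrite subSS -(subnSK im) [pochhammer _ (m - i.+1).+1]pochhammerSr
  (pochhammerSl (e + i.+1%:R)).
rewrite (_ : e + i.+1%:R + 1 = e + i.+2%:R); last by rewrite -!natr1; ring.
rewrite (_ : e + 2%:R * i.+1%:R + 1 + (m - i.+1)%:R = e + (m + i.+2)%:R); last first.
  by rewrite natrB// natrD -!natr1; ring.
rewrite binS natrD exprS.
have bin_rec : 'C(m, i.+1)%:R * i.+1%:R = (m%:R - i%:R) * 'C(m, i)%:R :> K.
  by rewrite -natrB ?(ltnW im)// -!natrM mulnC mul_bin_left.
have e1 : e + i.+1%:R != 0 by apply: e_neq0; lia.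
have e2 : e + 2%:R * i.+1%:R != 0 by rewrite -natrM; apply: e_neq0; lia.
have e3 : e + (m + i.+2)%:R != 0 by apply: e_neq0; lia.
have p1 : pochhammer (e + i.+2%:R) i != 0.
  by apply: pochhammer_neq0 => j ji; rewrite -addrA -natrD; apply: e_neq0; lia.
have p2 : pochhammer (e + 2%:R * i.+1%:R + 1) (m - i.+1) != 0.
  apply: pochhammer_neq0 => j ji.
  by rewrite -natrM -!addrA nat1r -natrD; apply: e_neq0; lia.
apply/eqP; rewrite -subr_eq0; apply/eqP.
(* Over a common denominator the discrepancy is a multiple of the combination that [bin_rec] makes
   zero. *)
transitivity ((-1) ^+ i * ((m%:R - i%:R) * 'C(m, i)%:R - 'C(m, i.+1)%:R * i.+1%:R)
   / ((e + i.+1%:R) * pochhammer (e + i.+2%:R) i * (e + 2%:R * i.+1%:R) *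
     pochhammer (e + 2%:R * i.+1%:R + 1) (m - i.+1) * (e + (m + i.+2)%:R))); last first.
  by rewrite bin_rec subrr mulr0 mul0r.
move: (pochhammer _ _) (pochhammer _ _) p1 p2 => u v p1 p2.
move: e1 e2 e3; rewrite natrD -[i.+2%:R]natr1 -[i.+1%:R]natr1 => e1 e2 e3.
field.
by rewrite p1 p2 e1 e2 e3.
Qed.

(** Isolates the dependence on [k] in a product of entries of two triangular matrices: the last
    factor is the summand of [alternating_sum_pochhammer] for [e = c + 2n - 1], [M = j - n] and
    index [k - n]. *)
Lemma connection_term c D N n j k :
  (n <= k)%N -> (k <= j)%N -> (j <= N)%N ->
  pochhammer (c + k%:R - 1) n != 0 ->
  pochhammer (c + 2%:R * n%:R - 1 + (k - n)%:R) (k - n) != 0 ->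
  pochhammer (c + 2%:R * k%:R) (N - k) != 0 ->
  pochhammer (c + 2%:R * k%:R) (j - k) != 0 ->
  pochhammer D n != 0 ->
  (N`!)%:R * pochhammer D k
    / ((k`!)%:R * pochhammer (c + k%:R - 1) k * pochhammer (c + 2%:R * k%:R) (N - k))
  * (pochhammer (- k%:R) n * pochhammer (k%:R + c - 1) n
     / (pochhammer D n * pochhammer (- N%:R) n))
  * (pochhammer (c + 2%:R * k%:R) (N - k) / ((N - k)`!)%:R
     * (pochhammer (- (N - k)%:R) (j - k) * pochhammer (D + k%:R) (j - k)
        / (pochhammer (c + 2%:R * k%:R) (j - k) * ((j - k)`!)%:R)))
  = (-1) ^+ (j - n) * ((N - n)`!)%:R * pochhammer D j
      / (pochhammer D n * ((N - j)`!)%:R * ((j - n)`!)%:R)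
    * ((-1) ^+ (k - n) * 'C(j - n, k - n)%:R
       / (pochhammer (c + 2%:R * n%:R - 1 + (k - n)%:R) (k - n)
          * pochhammer (c + 2%:R * n%:R - 1 + 2%:R * (k - n)%:R + 1)
              (j - n - (k - n)))).
Proof.
move=> nk kj jN p1 p2 p3 p4 p5; have nj := leq_trans nk kj; have kN := leq_trans kj jN.
have nN := leq_trans nk kN.
rewrite (natr_bin char0) ?leq_sub2r// subnBA// subnK//.
rewrite !pochhammer_oppn// ?leq_sub2r// subnBA// subnK//.
have -> : pochhammer D j = pochhammer D k * pochhammer (D + k%:R) (j - k).
  by rewrite -pochhammerD subnKC.
(* The first [n] factors cancel against the numerator, and the rest is the first symbol of the
   alternating sum. *)
have -> : pochhammer (c + k%:R - 1) k = pochhammer (c + k%:R - 1) n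
    * pochhammer (c + 2%:R * n%:R - 1 + (k - n)%:R) (k - n).
  rewrite -{2}(subnKC nk) pochhammerD; congr (_ * pochhammer _ _).
  by rewrite natrB//; ring.
have -> : c + 2%:R * n%:R - 1 + 2%:R * (k - n)%:R + 1 = c + 2%:R * k%:R.
  by rewrite natrB//; ring.
have -> : (-1) ^+ (j - k) = (-1) ^+ (j - n) * (-1) ^+ (k - n) :> K.
  by rewrite -exprD -signr_odd -[RHS]signr_odd !oddD !oddB//; do 3 case: (odd _).
rewrite (_ : k%:R + c - 1 = c + k%:R - 1); last by ring.
have sn : (-1) ^+ n != 0 :> K by rewrite signr_eq0.
have f m := natr_fact_neq0 char0 m.
field.
by rewrite p1 p2 p3 p4 p5 sn !f.
Qed.

(** The shifts are [k + r - 1] with [r < m <= k], so they range within [0, ..., 2N - 2]; the upper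
    end is reached at [k = m = N]. *)
Lemma pochhammer_pred_neq0 c N k m : (k <= N)%N -> (m <= k)%N ->
  (forall i, (i <= 2 * N - 2)%N -> c + i%:R != 0) ->
  pochhammer (c + k%:R - 1) m != 0.
Proof.
move=> kN mk c_neq0; apply: pochhammer_neq0 => r rm.
rewrite (_ : c + k%:R - 1 + r%:R = c + (k + r - 1)%:R).
  by apply: c_neq0; lia.
by rewrite natrB ?natrD; [ring | lia].
Qed.

Lemma pochhammer_double_neq0 c N k m : (m <= N - k)%N ->
  (forall i, (i <= 2 * N - 2)%N -> c + i%:R != 0) ->
  pochhammer (c + 2%:R * k%:R) m != 0.
Proof.
move=> mNk c_neq0; apply: pochhammer_neq0 => r rm.
by rewrite -natrM -addrA -natrD; apply: c_neq0; lia.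
Qed.

(** The two triangular matrices are inverse to each other: off the diagonal the entry of the product
    is an alternating sum that telescopes to 0, on the diagonal one term remains. *)
Lemma connection_sum c D N n j : (n <= N)%N -> (j <= N)%N ->
  (forall i, (i <= 2 * N - 2)%N -> c + i%:R != 0) ->
  pochhammer D n != 0 ->
  \sum_(k < N.+1 | (k <= j)%N)
  (N`!)%:R * pochhammer D k
    / ((k`!)%:R * pochhammer (c + k%:R - 1) k * pochhammer (c + 2%:R * k%:R) (N - k))
  * (pochhammer (- k%:R) n * pochhammer (k%:R + c - 1) n
     / (pochhammer D n * pochhammer (- N%:R) n))
  * (pochhammer (c + 2%:R * k%:R) (N - k) / ((N - k)`!)%:R
     * (pochhammer (- (N - k)%:R) (j - k) * pochhammer (D + k%:R) (j - k)
        / (pochhammer (c + 2%:R * k%:R) (j - k) * ((j - k)`!)%:R)))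
  = (j == n)%:R.
Proof.
move=> nN jN c_neq0 Dn.
pose C : K := (-1) ^+ (j - n) * ((N - n)`!)%:R * pochhammer D j
      / (pochhammer D n * ((N - j)`!)%:R * ((j - n)`!)%:R).
pose F i : K := C * ((-1) ^+ i * 'C(j - n, i)%:R
       / (pochhammer (c + 2%:R * n%:R - 1 + i%:R) i
          * pochhammer (c + 2%:R * n%:R - 1 + 2%:R * i%:R + 1) (j - n - i))).
(* For [k < n] the symbol [pochhammer (- k%:R) n] contains the factor 0. *)
rewrite (bigID (fun k : 'I__ => n <= k)%N) /= [X in _ + X]big1 ?addr0; last first.
  move=> k /andP[_]; rewrite -ltnNge => kn.
  by rewrite (pochhammer_oppn_eq0 _ kn) !(mul0r, mulr0).
transitivity (\sum_(k < N.+1 | (k <= j)%N && (n <= k)%N) F (k - n)%N).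
  apply: eq_bigr => k /andP[kj nk]; apply: connection_term => //.
  - by apply: (pochhammer_pred_neq0 (N := N)) => //; lia.
  - apply: pochhammer_neq0 => r rn.
    rewrite (_ : _ + r%:R = c + (k + n + r - 1)%:R); last first.
      by rewrite !natrB ?natrD; [ring | lia | lia].
    by apply: c_neq0; lia.
  - exact: pochhammer_double_neq0 c_neq0.
  - by apply: pochhammer_double_neq0 c_neq0; lia.
have [jn|nj] := ltnP j n.
  rewrite big_pred0 => [|k]; first by rewrite ltn_eqF.
  by apply/negbTE; rewrite negb_and -!ltnNge; lia.
have -> : \sum_(k < N.+1 | (k <= j)%N && (n <= k)%N) F (k - n)%N
    = \sum_(i < (j - n).+1) F i.
  rewrite sum_ord_shift//.
  rewrite (big_ord_widen_cond N.+1 (leq n) (fun k => F (k - n)%N))//.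
  by apply: eq_bigl => k; rewrite andbC.
rewrite -mulr_sumr; have [jn|neq_jn] := eqVneq j n.
  rewrite jn subnn big_ord_recl big_ord0 bin0 subn0 !pochhammer0.
  rewrite /C jn subnn fact0 /= !expr0 mulr1n; field.
  by rewrite Dn oner_eq0 natr_fact_neq0.
rewrite alternating_sum_pochhammer ?mulr0// => [|i /andP[i0 iM]]; first by lia.
rewrite (_ : _ + i%:R = c + (2 * n + i - 1)%:R); last first.
  by rewrite natrB ?natrD ?natrM; [ring | lia].
by apply: c_neq0; lia.
Qed.

Definition connection_weight c D N k : K :=
  (N`!)%:R * pochhammer D k
  / ((k`!)%:R * pochhammer (c + k%:R - 1) k * pochhammer (c + 2%:R * k%:R) (N - k)).

(** Inverts [hjacobi_hypergeometric]: substituting that expansion on the right and exchanging the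
    sums leaves the matrix product computed in [connection_sum]. *)
Lemma hjacobi_connection (A : comAlgType K) c lam N n (y z : A) : (n <= N)%N ->
  (forall i, (i <= 2 * N - 2)%N -> c + i%:R != 0) ->
  (forall i, (i <= 2 * N - 2)%N -> c + lam + i%:R != 0) ->
  y ^+ n * (y + z) ^+ (N - n) =
  \sum_(k < N.+1)
    (connection_weight c (c + lam + N%:R - 1) N k
     * (pochhammer (- k%:R) n * pochhammer (k%:R + c - 1) n
        / (pochhammer (c + lam + N%:R - 1) n * pochhammer (- N%:R) n)))
    *: (y ^+ k * hjacobi (N - k) (c + 2%:R * k%:R) lam y z).
Proof.
move=> nN c_neq0 clam_neq0; set D := c + lam + N%:R - 1.
have Dn : pochhammer D n != 0.
  apply: pochhammer_neq0 => r rn.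
  rewrite (_ : D + r%:R = c + lam + (N + r - 1)%:R); last first.
    by rewrite natrB ?natrD /D; [ring | lia].
  by apply: clam_neq0; lia.
pose h j k : K := pochhammer (c + 2%:R * k%:R) (N - k) / ((N - k)`!)%:R
     * (pochhammer (- (N - k)%:R) (j - k) * pochhammer (D + k%:R) (j - k)
        / (pochhammer (c + 2%:R * k%:R) (j - k) * ((j - k)`!)%:R)).
have expand k : (k <= N)%N -> y ^+ k * hjacobi (N - k) (c + 2%:R * k%:R) lam y z
    = \sum_(j < N.+1 | (k <= j)%N) h j k *: (y ^+ j * (y + z) ^+ (N - j)).
  move=> kN; rewrite hjacobi_hypergeometric//; last first.
    move=> i iNk; rewrite -natrM -addrA -natrD; apply: c_neq0; lia.
  rewrite mulr_sumr (sum_ord_shift (fun m => y ^+ k *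
    ((pochhammer (c + 2%:R * k%:R) (N - k) / ((N - k)`!)%:R
      * (pochhammer (- (N - k)%:R) m
         * pochhammer ((N - k)%:R + (c + 2%:R * k%:R) + lam - 1) m
         / (pochhammer (c + 2%:R * k%:R) m * (m`!)%:R)))
     *: (y ^+ m * (y + z) ^+ (N - k - m))))) //.
  apply: eq_bigr => j kj.
  rewrite -scalerAr [y ^+ k * _]mulrA -exprD subnKC// subnBA// subnK//.
  (* The upper parameter [(N - k) + (c + 2k) + lam - 1] equals [D + k]. *)
  rewrite /h; congr ((_ * (_ * pochhammer _ _ / _)) *: _).
  by rewrite natrB// /D; ring.
transitivity (\sum_(k < N.+1) \sum_(j < N.+1 | (k <= j)%N)
   (connection_weight c D N k * (pochhammer (- k%:R) n * pochhammer (k%:R + c - 1) n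
        / (pochhammer D n * pochhammer (- N%:R) n)) * h j k)
      *: (y ^+ j * (y + z) ^+ (N - j))); last first.
  apply: eq_bigr => k _; rewrite (expand k (ltn_ord k)) scaler_sumr.
  by apply: eq_bigr => j _; rewrite scalerA.
rewrite (exchange_big_dep xpredT)//=.
under eq_bigr => j _.
  rewrite -scaler_suml.
  rewrite (connection_sum nN (ltn_ord j) c_neq0 Dn); over.
rewrite (bigD1 (Ordinal (nN : (n < N.+1)%N)))//= eqxx scale1r big1 ?addr0// => j.
by rewrite -val_eqE => /negbTE /= ->; rewrite scale0r.
Qed.

(** Groups each 4F3 term into a 2F1 coefficient in [l] and an inversion coefficient in [k]. The
    range can be extended from [minn k l] to [l] because [pochhammer (- k%:R) n] vanishes for
    [n > k]. *)
Lemma racahE N (lam1 lam2 lam3 : K) l k :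
  racah N lam1 lam2 lam3 l k = \sum_(n < l.+1)
    pochhammer (- l%:R) n * pochhammer (l%:R + lam2 + lam3 - 1) n
      / (pochhammer lam2 n * (n`!)%:R)
    * (pochhammer (- k%:R) n * pochhammer (k%:R + (lam1 + lam2) - 1) n
       / (pochhammer (lam1 + lam2 + lam3 + N%:R - 1) n * pochhammer (- N%:R) n)).
Proof.
rewrite /racah /hyp4F3_upto.
rewrite (big_ord_widen l.+1 (fun n =>
   (pochhammer (- l%:R) n * pochhammer (l%:R + lam2 + lam3 - 1) n
    * pochhammer (- k%:R) n * pochhammer (k%:R + lam1 + lam2 - 1) n)
    / (pochhammer lam2 n * pochhammer (lam1 + lam2 + lam3 + N%:R - 1) n
       * pochhammer (- N%:R) n)
    * (1 ^+ n / (n`!)%:R))) ?ltnS ?geq_minl//.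
rewrite big_mkcond /=; apply: eq_bigr => n _.
rewrite ltnS leq_min -ltnS ltn_ord /=; case: leqP => [_|kn].
  by rewrite expr1n !addrA !invfM; ring.
by rewrite (pochhammer_oppn_eq0 _ kn) !(mul0r, mulr0).
Qed.

Lemma hjacobi_racah (A : comAlgType K) lam1 lam2 lam3 N l (y z : A) : (l <= N)%N ->
  (forall i, (i <= N - 1)%N -> lam2 + i%:R != 0) ->
  (forall i, (i <= 2 * N - 2)%N -> lam1 + lam2 + i%:R != 0) ->
  (forall i, (i <= 2 * N - 2)%N -> lam1 + lam2 + lam3 + i%:R != 0) ->
  (y + z) ^+ (N - l) * hjacobi l lam2 lam3 y z =
  \sum_(k < N.+1)
    (pochhammer lam2 l / (l`!)%:R
     * connection_weight (lam1 + lam2) (lam1 + lam2 + lam3 + N%:R - 1) N k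
     * racah N lam1 lam2 lam3 l k)
    *: (y ^+ k * hjacobi (N - k) (lam1 + lam2 + 2%:R * k%:R) lam3 y z).
Proof.
move=> lN h2 h12 h123.
rewrite hjacobi_hypergeometric//; last by move=> i il; apply: h2; lia.
rewrite mulr_sumr.
under eq_bigr => n _.
  (* The outer power completes each term to [y^n (y + z)^(N - n)], which [hjacobi_connection]
     expands. *)
  rewrite -scalerAr [(y + z) ^+ _ * _]mulrCA -exprD addnBA; last exact: ltn_ord n.
  rewrite subnK//.
  rewrite (hjacobi_connection _ _ (leq_trans (ltn_ord n : (n <= l)%N) lN) h12 h123).
  rewrite scaler_sumr; under eq_bigr do rewrite scalerA; over.
rewrite exchange_big /=; apply: eq_bigr => k _; rewrite -scaler_suml; congr (_ *: _).
rewrite racahE mulr_sumr; apply: eq_bigr => n _.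
by ring.
Qed.
End ConnectionCoefficients.

(** * The weighted Laplacian, its product rule and its kernel *)

Section WeightedLaplacian.
Variables (K : fieldType) (n : nat) (lam : 'I_n -> K).
Implicit Types (f g h : {mpoly K[n]}) (S T : {set 'I_n}).

Definition laplacian f : {mpoly K[n]} :=
  \sum_i ('X_i * (f^`M(i))^`M(i) + lam i *: f^`M(i)).

Definition carre_du_champ f g : {mpoly K[n]} := \sum_i 'X_i * (f^`M(i) * g^`M(i)).

Local Notation L := laplacian.
Local Notation G := carre_du_champ.

Lemma laplacian_is_linear : linear L.
Proof.
move=> c f g; rewrite scaler_sumr -big_split /=; apply: eq_bigr => i _.
by rewrite !linearP /= -!mul_mpolyC; ring.
Qed.

HB.instance Definition _ := GRing.isLinear.Build K {mpoly K[n]} {mpoly K[n]} _ L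
  laplacian_is_linear.

Lemma carre_du_champ_is_linear f : linear (G f).
Proof.
move=> c g h; rewrite scaler_sumr -big_split /=; apply: eq_bigr => i _.
by rewrite !linearP /= -!mul_mpolyC; ring.
Qed.

HB.instance Definition _ f := GRing.isLinear.Build K {mpoly K[n]} {mpoly K[n]} _
  (G f) (carre_du_champ_is_linear f).

Lemma laplacianM f g : L (f * g) = f * L g + L f * g + G f g *+ 2.
Proof.
rewrite mulr_sumr mulr_suml -sumrMnl -!big_split /=; apply: eq_bigr => i _.
by rewrite !mderivM !mderivD !mderivM scalerDr -!mul_mpolyC; ring.
Qed.

Lemma carre_du_champM f g h : G f (g * h) = g * G f h + G f g * h.
Proof.
rewrite mulr_sumr mulr_suml -!big_split /=; apply: eq_bigr => i _.
by rewrite mderivM; ring.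
Qed.

Lemma carre_du_champX f g m : G f (g ^+ m) = (g ^+ m.-1 * G f g) *+ m.
Proof.
case: m => [|m].
  by rewrite expr0 mulr0n; apply: big1 => i _; rewrite -mpolyC1 mderivC !mulr0.
elim: m => [|m IHm]; first by rewrite expr0 mul1r.
by rewrite exprS carre_du_champM IHm /= mulrnAr mulrA -exprS [G f g * _]mulrC -mulrSr.
Qed.

Definition setsum S : {mpoly K[n]} := \sum_(i in S) 'X_i.

Lemma mderiv_setsum S i : (setsum S)^`M(i) = (i \in S)%:R.
Proof.
rewrite /setsum raddf_sum /=.
have dX j : ('X_j : {mpoly K[n]})^`M(i) = (j == i)%:R.
  rewrite mderivX mnm1E; case: eqP => [->|_]; last by rewrite scale0r.
  by rewrite -{1}[U_(i)%MM]add0m addmK mpolyX0 scale1r.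
under eq_bigr do rewrite dX.
have [iS|iS] := boolP (i \in S).
  by rewrite (bigD1 i)//= eqxx big1 ?addr0// => j /andP[_ /negbTE->].
by rewrite big1// => j jS; case: eqP => // ji; rewrite -ji jS in iS.
Qed.

Lemma laplacian_setsum S : L (setsum S) = (\sum_(i in S) lam i)%:A.
Proof.
rewrite scaler_suml big_mkcond; apply: eq_bigr => i _.
rewrite mderiv_setsum; case: (i \in S).
  by rewrite -mpolyC1 mderivC mulr0 add0r.
by rewrite mderiv0 mulr0 scaler0 addr0.
Qed.

(** A partial sum of variables thus behaves like one variable, and sums over disjoint sets like
    distinct variables: this supplies the conditions on [f] and [h] in [laplacian_hjacobi]. *)
Lemma carre_du_champ_setsum S T : G (setsum S) (setsum T) = setsum (S :&: T).
Proof.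
rewrite {3}/setsum [RHS]big_mkcond; apply: eq_bigr => i _.
by rewrite !mderiv_setsum inE -natrM mulnb mulr_natr mulrb.
Qed.

(** Here [f] acts as a variable of weight [a]; a cofactor of degree [b] in [f] shifts that weight by
    [2b] through the cross term of the product rule. This is the source of the shifts by [2l] in the
    Jacobi parameters. *)
Lemma laplacian_exprM f g m (a b : K) :
  L f = a%:A -> G f f = f -> G f g = b *: g ->
  L (f ^+ m * g) = f ^+ m * L g
    + (m%:R * (m.-1%:R + a + b *+ 2)) *: (f ^+ m.-1 * g).
Proof.
move=> Lf Gff Gfg.
elim: m => [|m IHm]; first by rewrite expr0 !mul1r mul0r scale0r addr0.
rewrite exprS -mulrA laplacianM IHm Lf carre_du_champM carre_du_champX Gff Gfg /=.
case: m IHm => [|m] _ /=.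
  by rewrite !expr0 -!mul_mpolyC ?mpolyCD ?mpolyCM ?rmorph0 ?rmorph1; ring.
rewrite -[m.+2%:R]natr1 -[m.+1%:R]natr1 -!mul_mpolyC.
rewrite ?(mpolyCD,mpolyCM,mpolyC1,mpolyCMn) !exprS.
ring.
Qed.

(** [carre_du_champ f] is a derivation, so a form of degree [l] in two eigenvectors of eigenvalue
    [e] has eigenvalue [l e]. *)
Lemma carre_du_champ_hjacobi f u v l (a b e : K) :
  G f u = e *: u -> G f v = e *: v ->
  G f (hjacobi l a b u v) = (l%:R * e) *: hjacobi l a b u v.
Proof.
move=> Gu Gv.
have GX w m : G f w = e *: w -> G f (w ^+ m) = (m%:R * e) *: w ^+ m.
  case: m => [|m] Gw; rewrite carre_du_champX ?mulr0n ?mul0r ?scale0r// Gw.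
  by rewrite -scalerAr -exprSr -scaler_nat scalerA.
rewrite linear_sum scaler_sumr; apply: eq_bigr => s _.
rewrite linearZ /= carre_du_champM !GX// -scalerAr -scalerAl -scalerDl !scalerA.
congr (_ *: _); rewrite -mulrDl -natrD subnK; last exact: ltn_ord s.
by ring.
Qed.

Lemma laplacian_hjacobi l (a a' b b' : K) f h q :
  [pchar K] =i pred0 ->
  L f = a%:A -> G f f = f -> L h = a'%:A -> G h h = h -> G f h = 0 ->
  L q = 0 -> G f q = b *: q -> G h q = b' *: q ->
  L (hjacobi l (a + b *+ 2) (a' + b' *+ 2) f h * q) = 0.
Proof.
move=> char0 Lf Gff Lh Ghh Gfh Lq Gfq Ghq.
rewrite mulr_suml linear_sum /=.
pose c := jacobi_coef l (a + b *+ 2) (a' + b' *+ 2).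
transitivity (\sum_(s < l.+1)
   ((c s * ((l - s)%:R * ((l - s).-1%:R + a' + b' *+ 2)))
      *: (f ^+ s * (h ^+ (l - s).-1 * q))
  + (c s * (s%:R * (s.-1%:R + a + b *+ 2))) *: (f ^+ s.-1 * (h ^+ (l - s) * q)))).
  apply: eq_bigr => s _; rewrite -scalerAl linearZ /= -mulrA.
  rewrite (laplacian_exprM _ (b := b) Lf Gff); last first.
    rewrite carre_du_champM carre_du_champX Gfh mulr0 mul0rn mul0r addr0.
    by rewrite Gfq -scalerAr.
  rewrite (laplacian_exprM _ Lh Ghh Ghq) Lq mulr0 add0r.
  by rewrite scalerDr -scalerAr !scalerA.
(* The terms [s = l] of the first sum and [s = 0] of the second carry a zero factor. After a shift
   the remaining terms pair up on equal monomials and cancel by [jacobi_coef_rec]. *)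
rewrite big_split /= [X in X + _]big_ord_recr [X in _ + X]big_ord_recl /=.
rewrite subnn !(mul0r, mulr0, scale0r, addr0, add0r) -big_split big1//= => s _.
rewrite -subnS -scalerDl /bump /= add1n.
have := jacobi_coef_rec char0 (a + b *+ 2) (a' + b' *+ 2) (ltn_ord s).
rewrite addrC -/c !addrA => rec.
by rewrite rec scale0r.
Qed.

Lemma mcoeff_laplacian f m :
  (L f)@_m = \sum_i ((m i)%:R + lam i) * (m i).+1%:R * f@_(m + U_(i)).
Proof.
rewrite raddf_sum; apply: eq_bigr => i _.
rewrite /= mcoeffD mcoeffZ mcoeff_mderiv.
suff -> : ('X_i * (f^`M(i))^`M(i))@_m = (m i)%:R * ((m i).+1%:R * f@_(m + U_(i))).
  by rewrite -mulr_natl; ring.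
have [mi0|mi_gt0] := posnP (m i).
  rewrite mi0 mul0r [X in 'X_i * X]mpolyE mulr_sumr raddf_sum big1// => k _ /=.
  rewrite -scalerAr mcoeffZ -mpolyXD mcoeffX; case: eqP => [km|]; last by rewrite mulr0.
  by move: mi0; rewrite -km mnmDE mnm1E eqxx.
have {1}-> : m = (U_(i) + (m - U_(i)))%MM by rewrite addmC submK// lep1mP -lt0n.
rewrite mulrC mcoeffMX !mcoeff_mderiv submK ?lep1mP -?lt0n//.
rewrite mnmBE mnm1E eqxx subn1 prednK//.
by rewrite -[LHS]mulr_natl -[X in _ * X = _]mulr_natl.
Qed.

Lemma laplacian_kernel i0 N f :
  [pchar K] =i pred0 -> (forall i, (i < N)%N -> lam i0 + i%:R != 0) ->
  f \is N.-homog -> L f = 0 -> (forall m : 'X_{1..n}, m i0 = 0%N -> f@_m = 0) -> f = 0.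
Proof.
move=> char0 lam_neq0 fN Lf f0.
suff main d (m : 'X_{1..n}) : m i0 = d -> f@_m = 0.
  by apply/mpolyP => m; rewrite mcoeff0; apply: main erefl.
elim: d m => [|d IHd] m md; first exact: f0.
have mdE : m = (m - U_(i0) + U_(i0))%MM by rewrite submK// lep1mP md.
(* If [d >= N], the exponent [d.+1] already exceeds the degree of [f]. *)
have [dN|Nd] := ltnP d N; last first.
  have Nm : (N < mdeg m)%N.
    by rewrite mdegE (bigD1 i0)//= md; apply: leq_trans (leq_addr _ _).
  by apply: (dhomog_nemf_coeff fN); rewrite neq_ltn; apply/orP; right.
(* In this coefficient of the equation the summand [i0] is a nonzero multiple of [f@_m]; every other
   summand involves a monomial of exponent [d] in [i0]. *)
have /(congr1 (mcoeff (m - U_(i0))%MM)) := Lf.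
rewrite mcoeff0 mcoeff_laplacian (bigD1 i0)//= -mdE big1 ?addr0 => [|i ii0].
  rewrite mnmBE mnm1E eqxx md subn1 /= => /eqP.
  rewrite !mulf_eq0 addrC (negbTE (lam_neq0 _ dN)) natr_eq0//=.
  by move/eqP.
by rewrite IHd ?mulr0// mnmDE mnmBE !mnm1E eqxx (negbTE ii0) md subn1 addn0.
Qed.

End WeightedLaplacian.

(** * Homogeneity and restriction to a coordinate hyperplane *)

Lemma hjacobi_homog (K : fieldType) n l (a b : K) (u v : {mpoly K[n]}) :
  u \is 1.-homog -> v \is 1.-homog -> hjacobi l a b u v \is l.-homog.
Proof.
move=> hu hv; apply: rpred_sum => s _; apply: dhomogZ.
have sl : (s <= l)%N := ltn_ord s.
have := dhomogM (dhomogMn s hu) (dhomogMn (l - s) hv).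
by rewrite !mul1n subnKC.
Qed.

Definition kill_var (K : fieldType) n (i0 : 'I_n) : {mpoly K[n]} -> {mpoly K[n]} :=
  comp_mpoly [tuple if i == i0 then 0 else 'X_i | i < n].

Lemma mcoeff_kill_var (K : fieldType) n (i0 : 'I_n) (f : {mpoly K[n]}) (m : 'X_{1..n}) :
  m i0 = 0%N -> (kill_var i0 f)@_m = f@_m.
Proof.
move=> m0; rewrite [in RHS](mpolyE f) /kill_var comp_mpolyEX !raddf_sum.
apply: eq_bigr => k _ /=; rewrite !mcoeffZ comp_mpolyX mcoeffX; congr (_ * _).
have [k0|k0] := posnP (k i0).
  rewrite -mcoeffX mpolyXE_id; congr (mcoeff _ _); apply: eq_bigr => i _.
  by rewrite tnth_mktuple; case: eqP => [->|//]; rewrite k0 !expr0.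
rewrite (bigD1 i0)//= tnth_mktuple eqxx expr0n -[_ == 0%N]negbK -lt0n k0 mul0r mcoeff0.
by case: eqP => // km; rewrite km m0 in k0.
Qed.

(** * The two bases in homogenised form and their harmonicity *)

Section HomogeneousBases.
Variable K : fieldType.
Hypothesis char0 : [pchar K] =i pred0.
Implicit Types (lam : K) (N k l : nat).

Definition hbasis_v (A : comAlgType K) N lam1 lam2 lam3 l (x y z : A) : A :=
  hjacobi (N - l) (lam1 + lam2 + 2%:R * l%:R) lam3 (x + y) z
  * hjacobi l lam1 lam2 x y.

Definition hbasis_w (A : comAlgType K) N lam1 lam2 lam3 l (x y z : A) : A :=
  hjacobi (N - l) lam1 (lam2 + lam3 + 2%:R * l%:R) x (y + z)
  * hjacobi l lam2 lam3 y z.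

(** Both Jacobi factors are reflected; their signs combine to [(-1)^(N - l) (-1)^l], which is
    independent of [l]. *)
Lemma hbasis_w_reverse (A : comAlgType K) N lam1 lam2 lam3 l (x y z : A) :
  (l <= N)%N ->
  hbasis_w N lam1 lam2 lam3 l x y z
    = (-1) ^+ N *: hbasis_v N lam3 lam2 lam1 l z y x.
Proof.
move=> lN; rewrite /hbasis_w /hbasis_v [z + y]addrC [lam3 + lam2]addrC.
rewrite hjacobi_swap// [hjacobi l lam2 _ _ _]hjacobi_swap//.
by rewrite -scalerAl -scalerAr scalerA -exprD subnK.
Qed.

Definition overlap N lam1 lam2 lam3 l k : K :=
  'C(N, l)%:R
  * (pochhammer lam2 l * pochhammer lam1 (N - l)
     * pochhammer (lam1 + lam2 + lam3 + N%:R - 1) k)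
  / (pochhammer lam1 k * pochhammer (lam1 + lam2 + k%:R - 1) k
     * pochhammer (lam1 + lam2 + 2%:R * k%:R) (N - k))
  * racah N lam1 lam2 lam3 l k.

(** Duality of the Racah polynomials: the exchange only permutes the upper parameters of the 4F3. *)
Lemma racah_reverse N lam1 lam2 lam3 k l :
  racah N lam3 lam2 lam1 l k = racah N lam1 lam2 lam3 k l.
Proof.
rewrite /racah minnC (_ : lam3 + lam2 + lam1 = lam1 + lam2 + lam3); last by ring.
rewrite [l%:R + _ + _]addrAC [k%:R + lam3 + _]addrAC /hyp4F3_upto.
by apply: eq_bigr => n _; congr (_ / _ * _); ring.
Qed.

Lemma laplacian_hjacobi_setsum n (lam : 'I_n -> K) (S T : {set 'I_n}) l
    (b b' : K) (q : {mpoly K[n]}) :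
  S :&: T = set0 -> laplacian lam q = 0 ->
  carre_du_champ (setsum K S) q = b *: q ->
  carre_du_champ (setsum K T) q = b' *: q ->
  laplacian lam (hjacobi l (\sum_(i in S) lam i + b *+ 2)
    (\sum_(i in T) lam i + b' *+ 2) (setsum K S) (setsum K T) * q) = 0.
Proof.
move=> ST; apply: laplacian_hjacobi => //; rewrite ?laplacian_setsum//.
- by rewrite carre_du_champ_setsum setIid.
- by rewrite carre_du_champ_setsum setIid.
- by rewrite carre_du_champ_setsum ST /setsum big_set0.
Qed.

Lemma laplacian_hjacobiXX n (lam : 'I_n -> K) l i j : i != j ->
  laplacian lam (hjacobi l (lam i) (lam j) 'X_i 'X_j) = 0.
Proof.
move=> ij.
have := @laplacian_hjacobi_setsum _ lam [set i] [set j] l 0 0 1.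
rewrite /setsum !big_set1 mulr1 !mul0rn !addr0; apply.
- by apply/setP => r; rewrite !inE; case: eqP => // ->; rewrite (negbTE ij).
- apply: big1 => r _; rewrite -mpolyC1 mderivC mderiv0 mulr0 scaler0 addr0//.
- by rewrite scale0r; apply: big1 => r _; rewrite -mpolyC1 mderivC !mulr0.
- by rewrite scale0r; apply: big1 => r _; rewrite -mpolyC1 mderivC !mulr0.
Qed.

Lemma carre_du_champ_hjacobiXX n (S : {set 'I_n}) l (a b : K) i j :
  (i \in S) = (j \in S) ->
  carre_du_champ (setsum K S) (hjacobi l a b 'X_i 'X_j)
  = (l%:R * (i \in S)%:R) *: hjacobi l a b 'X_i 'X_j.
Proof.
have GX r : carre_du_champ (setsum K S) 'X_r = (r \in S)%:R *: 'X_r.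
  have {1}-> : 'X_r = setsum K [set r] by rewrite /setsum big_set1.
  rewrite carre_du_champ_setsum /setsum; have [rS|rS] := boolP (r \in S).
    by rewrite (setIidPr _) ?sub1set// big_set1 scale1r.
  rewrite scale0r (_ : _ :&: _ = set0) ?big_set0//.
  by apply/eqP; rewrite setI_eq0 disjoint_sym disjoints1.
by move=> ij; apply: carre_du_champ_hjacobi; rewrite GX// ij.
Qed.

(** * Expansion of one basis in the other for three distinct variables *)

Section Kernel.
Variables (n : nat) (lam : 'I_n -> K) (i j k : 'I_n).
Hypotheses (ij : i != j) (ik : i != k) (jk : j != k).

Lemma homogX (r : 'I_n) : ('X_r : {mpoly K[n]}) \is 1.-homog.
Proof. by rewrite dhomogX; apply/eqP; apply: mdeg1. Qed.

(** The inner factor is harmonic, of degree [l] in ['X_i + 'X_j] and 0 in ['X_k], so the outer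
    parameter has to be [lam i + lam j + 2l]. *)
Lemma laplacian_hbasis_v N l :
  laplacian lam (hbasis_v N (lam i) (lam j) (lam k) l 'X_i 'X_j 'X_k) = 0.
Proof.
have := @laplacian_hjacobi_setsum _ lam [set i; j] [set k] (N - l) l%:R 0
  (hjacobi l (lam i) (lam j) 'X_i 'X_j).
rewrite /setsum !big_setU1 ?inE//= !big_set1 mul0rn addr0 /hbasis_v mulr_natl; apply.
- apply/eqP; rewrite setI_eq0 disjoint_sym disjoints1 !inE negb_or.
  by rewrite ![k == _]eq_sym ik jk.
- exact: laplacian_hjacobiXX.
- have := @carre_du_champ_hjacobiXX _ [set i; j] l (lam i) (lam j) i j.
  by rewrite /setsum !big_setU1 ?inE//= !big_set1 !eqxx orbT mulr1; apply.
- have := @carre_du_champ_hjacobiXX _ [set k] l (lam i) (lam j) i j.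
  by rewrite /setsum !big_set1 !inE (negbTE ik) (negbTE jk) mulr0; apply.
Qed.

Lemma laplacian_hbasis_w N l :
  laplacian lam (hbasis_w N (lam i) (lam j) (lam k) l 'X_i 'X_j 'X_k) = 0.
Proof.
have := @laplacian_hjacobi_setsum _ lam [set i] [set j; k] (N - l) 0 l%:R
  (hjacobi l (lam j) (lam k) 'X_j 'X_k).
rewrite /setsum !big_setU1 ?inE//= !big_set1 mul0rn addr0 /hbasis_w mulr_natl; apply.
- by apply/eqP; rewrite setI_eq0 disjoints1 !inE negb_or ij ik.
- exact: laplacian_hjacobiXX.
- have := @carre_du_champ_hjacobiXX _ [set i] l (lam j) (lam k) j k.
  rewrite /setsum !big_set1 !inE ![_ == i]eq_sym (negbTE ij) (negbTE ik).
  by rewrite mulr0; apply.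
- have := @carre_du_champ_hjacobiXX _ [set j; k] l (lam j) (lam k) j k.
  by rewrite /setsum !big_setU1 ?inE//= !big_set1 !eqxx orbT mulr1; apply.
Qed.

Lemma hbasis_v_homog N l (lam1 lam2 lam3 : K) : (l <= N)%N ->
  hbasis_v N lam1 lam2 lam3 l ('X_i : {mpoly K[n]}) 'X_j 'X_k \is N.-homog.
Proof.
move=> lN; rewrite -{2}(subnK lN); apply: dhomogM; apply: hjacobi_homog => //.
all: by rewrite ?rpredD ?homogX.
Qed.

Lemma hbasis_w_homog N l (lam1 lam2 lam3 : K) : (l <= N)%N ->
  hbasis_w N lam1 lam2 lam3 l ('X_i : {mpoly K[n]}) 'X_j 'X_k \is N.-homog.
Proof.
move=> lN; rewrite -{2}(subnK lN); apply: dhomogM; apply: hjacobi_homog => //.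
all: by rewrite ?rpredD ?homogX.
Qed.

Lemma hbasis_wX N l : (l <= N)%N ->
  (forall r, (r <= N - 1)%N -> lam i + r%:R != 0) ->
  (forall r, (r <= N - 1)%N -> lam j + r%:R != 0) ->
  (forall r, (r <= 2 * N - 2)%N -> lam i + lam j + r%:R != 0) ->
  (forall r, (r <= 2 * N - 2)%N -> lam i + lam j + lam k + r%:R != 0) ->
  hbasis_w N (lam i) (lam j) (lam k) l ('X_i : {mpoly K[n]}) 'X_j 'X_k =
  \sum_(r < N.+1) overlap N (lam i) (lam j) (lam k) l r *:
    hbasis_v N (lam i) (lam j) (lam k) r 'X_i 'X_j 'X_k.
Proof.
move=> lN h1 h2 h12 h123; apply/eqP; rewrite -subr_eq0; apply/eqP.
apply: (laplacian_kernel (lam := lam) (i0 := i) (N := N) char0).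
- by move=> r rN; apply: h1; lia.
- apply: rpredB; first exact: hbasis_w_homog.
  apply: rpred_sum => r _; apply: rpredZ; apply: hbasis_v_homog; exact: ltn_ord r.
- rewrite linearB /= laplacian_hbasis_w [X in _ - X]linear_sum /=.
  rewrite big1 ?subr0// => r _.
  by rewrite [LHS]linearZ /= laplacian_hbasis_v scaler0.
(* It remains to show that the difference vanishes when ['X_i] is set to 0. *)
move=> m m0; rewrite -(mcoeff_kill_var _ m0) (_ : kill_var _ _ = 0) ?mcoeff0//.
have kX r : comp_mpoly [tuple if i' == i then 0 else 'X_i' : {mpoly K[n]} | i' < n] 'X_r
    = if r == i then 0 else 'X_r.
  by rewrite comp_mpolyXU -tnth_nth tnth_mktuple.
rewrite /kill_var rmorphB rmorph_sum /= rmorphM /= !hjacobi_morph /= rmorphD /=.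
rewrite !kX eqxx ![_ == i]eq_sym (negbTE ij) (negbTE ik).
(* The factor whose first argument became 0 collapses to a scalar times a power of ['X_j + 'X_k],
   which leaves the two-variable identity. *)
rewrite hjacobi0l// -scalerAl (hjacobi_racah char0 _ _ lN h2 h12 h123).
rewrite scaler_sumr -sumrB big1// => r _.
rewrite comp_mpolyZ rmorphM /= !hjacobi_morph /= rmorphD /= !kX eqxx.
rewrite ![_ == i]eq_sym (negbTE ij) (negbTE ik) add0r hjacobi0l//.
rewrite -scalerAr [X in _ *: (_ *: X)]mulrC !scalerA -scalerBl.
rewrite [X in X *: _](_ : _ = 0) ?scale0r//.
(* The collapsed factors on the two sides give [pochhammer (lam i) (N - l) / (N - l)!] and
   [pochhammer (lam i) r / r!], whose quotient enters [overlap]. *)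
rewrite /overlap /connection_weight (natr_bin char0 lN).
have rN : (r <= N)%N := ltn_ord r.
have p1 : pochhammer (lam i) r != 0.
  by apply: pochhammer_neq0 => s sr; apply: h1; lia.
have p2 := pochhammer_pred_neq0 rN (leqnn r) h12.
have p3 := pochhammer_double_neq0 (leqnn (N - r)) h12.
have f s := natr_fact_neq0 char0 s.
by field; rewrite p1 p2 p3 !f.
Qed.

End Kernel.

Definition var3 (r : nat) : {mpoly K[3]} := 'X_(inord r).

Definition nonvanishing N lam1 lam2 lam3 :=
  [/\ forall r, (r <= N - 1)%N -> lam1 + r%:R != 0,
      forall r, (r <= N - 1)%N -> lam2 + r%:R != 0,
      forall r, (r <= 2 * N - 2)%N -> lam1 + lam2 + r%:R != 0 &
      forall r, (r <= 2 * N - 2)%N -> lam1 + lam2 + lam3 + r%:R != 0].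

(** The identity between variables passes to arbitrary polynomials by substitution, so that it may
    also be used with the arguments in reverse order. *)
Lemma hbasis_w_expand N lam1 lam2 lam3 l (x y z : {mpoly K[3]}) : (l <= N)%N ->
  nonvanishing N lam1 lam2 lam3 ->
  hbasis_w N lam1 lam2 lam3 l x y z =
  \sum_(r < N.+1) overlap N lam1 lam2 lam3 l r *: hbasis_v N lam1 lam2 lam3 r x y z.
Proof.
move=> lN [h1 h2 h12 h123].
pose lam (i : 'I_3) := nth 0 [:: lam1; lam2; lam3] i.
have i0 : lam (inord 0) = lam1 by rewrite /lam inordK.
have i1 : lam (inord 1) = lam2 by rewrite /lam inordK.
have i2 : lam (inord 2) = lam3 by rewrite /lam inordK.
have neq r s : (r < 3)%N -> (s < 3)%N -> r != s -> (inord r : 'I_3) != inord s.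
  by move=> r3 s3; rewrite -val_eqE /= !inordK.
have := @hbasis_wX 3 lam (inord 0) (inord 1) (inord 2) (neq 0 1 _ _ _)%N
  (neq 0 2 _ _ _)%N (neq 1 2 _ _ _)%N N l lN.
rewrite i0 i1 i2 => /(_ isT isT isT isT isT isT isT isT isT h1 h2 h12 h123).
move/(congr1 (comp_mpoly [tuple x; y; z])).
rewrite rmorph_sum /= /hbasis_w rmorphM /= !hjacobi_morph /= rmorphD /=.
rewrite !comp_mpolyXU !inordK //= => ->; apply: eq_bigr => r _.
rewrite comp_mpolyZ /hbasis_v rmorphM /= !hjacobi_morph /= rmorphD /=.
by rewrite !comp_mpolyXU !inordK.
Qed.

Lemma hbasis_v_expand N lam1 lam2 lam3 l (x y z : {mpoly K[3]}) : (l <= N)%N ->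
  nonvanishing N lam3 lam2 lam1 ->
  hbasis_v N lam1 lam2 lam3 l x y z =
  \sum_(r < N.+1) overlap N lam3 lam2 lam1 l r *: hbasis_w N lam1 lam2 lam3 r x y z.
Proof.
move=> lN h.
have signK (p : {mpoly K[3]}) : (-1) ^+ N *: ((-1) ^+ N *: p) = p.
  by rewrite scalerA -expr2 sqrr_sign scale1r.
have := hbasis_w_expand z y x lN h.
rewrite (hbasis_w_reverse _ _ _ _ _ _ lN) => /(congr1 (fun p => (-1) ^+ N *: p)).
rewrite signK => ->; rewrite scaler_sumr; apply: eq_bigr => r _.
have rN : (r <= N)%N := ltn_ord r.
by rewrite (hbasis_w_reverse lam1 lam2 lam3 x y z rN) !scalerA mulrC.
Qed.

(** * Return to rational functions *)

Lemma cst_is_additive : additive (@cst K).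
Proof. by move=> a b; rewrite /cst mpolyCB rmorphB. Qed.

Lemma cst_is_multiplicative : multiplicative (@cst K).
Proof. by split=> [a b|]; rewrite /cst ?mpolyCM ?mpolyC1 ?rmorphM ?rmorph1. Qed.

HB.instance Definition _ := GRing.isAdditive.Build K (ratfun K) (@cst K)
  cst_is_additive.
HB.instance Definition _ := GRing.isMultiplicative.Build K (ratfun K) (@cst K)
  cst_is_multiplicative.

Lemma tofracZ c (p : {mpoly K[3]}) : tofrac (c *: p) = cst c * tofrac p.
Proof. by rewrite -mul_mpolyC rmorphM. Qed.

(** At this point [1 - u] and [1 + u] are [2a / (a + b)] and [2b / (a + b)], so each term yields
    [2^l / (a + b)^l], cancelled by the normalisation and the prefactor. *)
Lemma horner_jacobi (F : fieldType) (f : {rmorphism K -> F}) l lam lam' (a b : F) :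
  a + b != 0 ->
  (a + b) ^+ l * (map_poly f (jacobi l lam lam')).[(b - a) / (a + b)]
  = \sum_(s < l.+1) f (jacobi_coef l lam lam' s) * (a ^+ s * b ^+ (l - s)).
Proof.
move=> ab_neq0; set u := (b - a) / (a + b).
have two_neq0 : 2%:R != 0 :> F by rewrite -(rmorph_nat f) fmorph_eq0 natr_eq0.
have u1 : 1 - u = 2%:R * a / (a + b) by rewrite /u; field.
have u2 : 1 + u = 2%:R * b / (a + b) by rewrite /u; field.
rewrite /jacobi map_polyZ rmorph_sum hornerZ horner_sum.
rewrite mulrCA !mulr_sumr; apply: eq_bigr => s _; have sl : (s <= l)%N := ltn_ord s.
rewrite /= -/(jacobi_coef l lam lam' s) map_polyZ hornerZ.
move: (jacobi_coef _ _ _ _) => c; rewrite rmorphM /= !rmorphXn /= hornerM !horner_exp.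
rewrite rmorphB rmorphD /= rmorph1 map_polyX !hornerE /= u1 u2.
rewrite fmorphV rmorphXn rmorph_nat !exprMn !exprVn.
rewrite -[in 2%:R ^+ l](subnKC sl) -[in (a + b) ^+ l](subnKC sl) !exprD.
field.
by rewrite !expf_neq0.
Qed.

Lemma jacobi_at_tofrac l lam lam' (a b : {mpoly K[3]}) : a + b != 0 ->
  tofrac (a + b) ^+ l
  * jacobi_at l lam lam' ((tofrac b - tofrac a) / tofrac (a + b))
  = tofrac (hjacobi l lam lam' a b).
Proof.
rewrite -tofrac_eq0 rmorphD /= => ab_neq0.
rewrite [LHS]horner_jacobi// rmorph_sum; apply: eq_bigr => s _.
by rewrite /= tofracZ; congr (_ * _); rewrite rmorphM /= !rmorphXn.
Qed.

Lemma basis_vE N lam1 lam2 lam3 l :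
  basis_v N lam1 lam2 lam3 l
  = tofrac (hbasis_v N lam1 lam2 lam3 l (var3 0) (var3 1) (var3 2)).
Proof.
have [n01 _ n012] := sum_vars_neq0 K.
rewrite /hbasis_v rmorphM /= -!jacobi_at_tofrac// !rmorphD /=.
by rewrite mulrACA mulrA.
Qed.

Lemma basis_wE N lam1 lam2 lam3 l :
  basis_w N lam1 lam2 lam3 l
  = tofrac (hbasis_w N lam1 lam2 lam3 l (var3 0) (var3 1) (var3 2)).
Proof.
have [_ n12 n012] := sum_vars_neq0 K.
rewrite /hbasis_w rmorphM /= -!jacobi_at_tofrac ?addrA// !rmorphD /=.
by rewrite mulrACA mulrA.
Qed.

End HomogeneousBases.

Theorem theorem4p8 (R : realType) (N : nat) (lam1 lam2 lam3 : R[i])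
  (hN : (1 <= N)%N)
  (h1 : forall i : nat, (i <= N - 1)%N -> lam1 <> - i%:R)
  (h2 : forall i : nat, (i <= N - 1)%N -> lam2 <> - i%:R)
  (h3 : forall i : nat, (i <= N - 1)%N -> lam3 <> - i%:R)
  (h12 : forall i : nat, (i <= 2 * N - 2)%N -> lam1 + lam2 <> - i%:R)
  (h23 : forall i : nat, (i <= 2 * N - 2)%N -> lam2 + lam3 <> - i%:R)
  (h123 : forall i : nat, (i <= 2 * N - 2)%N -> lam1 + lam2 + lam3 <> - i%:R) :
  forall l : nat, (l <= N)%N ->
    basis_w N lam1 lam2 lam3 l =
      \sum_(k < N.+1)
        cst ('C(N, l)%:R
             * (pochhammer lam2 l * pochhammer lam1 (N - l)
                * pochhammer (lam1 + lam2 + lam3 + N%:R - 1) k)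
             / (pochhammer lam1 k * pochhammer (lam1 + lam2 + k%:R - 1) k
                * pochhammer (lam1 + lam2 + 2%:R * k%:R) (N - k))
             * racah N lam1 lam2 lam3 l k)
        * basis_v N lam1 lam2 lam3 k
    /\
    basis_v N lam1 lam2 lam3 l =
      \sum_(k < N.+1)
        cst ('C(N, l)%:R
             * (pochhammer lam2 l * pochhammer lam3 (N - l)
                * pochhammer (lam1 + lam2 + lam3 + N%:R - 1) k)
             / (pochhammer lam3 k * pochhammer (lam2 + lam3 + k%:R - 1) k
                * pochhammer (lam2 + lam3 + 2%:R * k%:R) (N - k))
             * racah N lam1 lam2 lam3 k l)
        * basis_w N lam1 lam2 lam3 k.
Proof.
have char0 := Num.Theory.pchar_num R[i].
have neq0 (a : R[i]) m : (forall i, (i <= m)%N -> a <> - i%:R) ->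
    forall i, (i <= m)%N -> a + i%:R != 0.
  by move=> h i /h/eqP; rewrite addr_eq0.
move=> l lN; split.
  rewrite basis_wE// (@hbasis_w_expand _ char0)//; last by split; apply: neq0.
  rewrite rmorph_sum; apply: eq_bigr => k _.
  by rewrite /= tofracZ basis_vE.
rewrite basis_vE// (@hbasis_v_expand _ char0)//; last first.
  split; apply: neq0 => // i im; rewrite [lam3 + lam2]addrC; first exact: h23.
  by rewrite [lam2 + lam3 + lam1]addrC addrA; apply: h123.
rewrite rmorph_sum; apply: eq_bigr => k _.
(* Exchanging [lam1] and [lam3] produced [R_{l,k}] for the reversed parameters, which duality turns
   into [R_{k,l}]. *)
rewrite /= tofracZ basis_wE// /overlap racah_reverse [lam3 + lam2]addrC.
by rewrite (_ : lam2 + lam3 + lam1 = lam1 + lam2 + lam3)//; ring.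
Qed.
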